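(* Let $\mu:\mathcal{P}(\mathcal{C})\to L^*$ be a capacity and let $f,g:\mathcal{C}\to L^*$ be two input vectors with $f\le_\ell g$ (i.e. $f_i\le_\ell g_i$ for all $i\in\mathcal{C}$). Then $$\int_{\mathrm{DPR},\mu}^{\otimes_D} f\;\le_\ell\; \int_{\mathrm{DPR},\mu}^{\otimes_D} g .$$
   Context: Residuated lattice: $L=(L,\wedge,\vee,\otimes,\to,0,1)$ is a linearly ordered residuated lattice: $(L,\wedge,\vee,0,1)$ is a linearly ordered lattice with bottom $0$ and top $1$ ($0\neq 1$), $(L,\otimes,1)$ is a commutative monoid, and $\alpha\otimes\beta\le\gamma$ iff $\alpha\le\beta\to\gamma$. The underlying ordered set of $L$ is either a closed real interval $[a,b]$ with $a<b$ or a finite subset of $[a,b]$ containing $a$ and $b$ (with $0,1$ denoting the bottom and top elements). Standing assumption: $L$ has no zero divisors with respect to $\otimes$, i.e. $\alpha\otimes\beta=0$ implies $\alpha=0$ or $\beta=0$. Dragonfly algebra: $L^*=L\cup\{*\}$ with $*\notin L$ (the ''unknown value''). Its linear order $\le_\ell$ extends the order of $L$ by $0<_\ell *<_\ell\alpha$ for all $\alpha\in L\setminus\{0\}$; $\wedge_D,\vee_D$ are the minimum and maximum with respect to $\le_\ell$, and $\bigwedge_D,\bigvee_D$ denote infimum and supremum with respect to $\le_\ell$ (with $\bigwedge_D\emptyset=1$, $\bigvee_D\emptyset=0$). The multiplication $\otimes_D$ on $L^*$ is: $\alpha\otimes_D\beta=\alpha\otimes\beta$ for $\alpha,\beta\in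 L$; $*\otimes_D 0=0\otimes_D *=0$; $*\otimes_D\alpha=\alpha\otimes_D *=*$ for $\alpha\in L\setminus\{0\}$; $*\otimes_D *=*$. $\mathcal{C}=\{1,\dots,n\}$ is a finite non-empty set with power set $\mathcal{P}(\mathcal{C})$. An input vector is a map $f:\mathcal{C}\to L^*$, $f_i=f(i)$. A capacity is a map $\mu:\mathcal{P}(\mathcal{C})\to L^*$ with $\mu(\emptyset)=0$, $\mu(\mathcal{C})=1$, and $A\subseteq B\Rightarrow\mu(A)\le_\ell\mu(B)$. The multiplication-based qualitative integral is $$\int_{\mathrm{DPR},\mu}^{\otimes_D} f=\bigvee_{D,\,A\subseteq\mathcal{C}}\Big(\mu(A)\otimes_D\bigwedge_{D,\,i\in A}f_i\Big).$$ *)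

(* Defs.v *)
From HB Require Import structures.
From mathcomp Require Import all_boot all_order all_algebra.
From mathcomp Require Import classical_sets cardinality set_interval reals.

Set Implicit Arguments.
Unset Strict Implicit.
Unset Printing Implicit Defensive.

Import Order.TTheory.
Local Open Scope order_scope.

HB.mixin Record isLinearResiduated d L of Order.TBTotal d L := {
  tens : L -> L -> L;
  imp : L -> L -> L;
  bot_neq_top : (\bot : L) != \top;
  tensA : associative tens;
  tensC : commutative tens;
  tens1x : left_id \top tens;
  tens_imp : forall x y z : L, (tens x y <= z) = (x <= imp y z)
}.

#[short(type="linResLatticeType")]
HB.structure Definition LinearResiduated d :=
  { L of isLinearResiduated d L & Order.TBTotal d L }.

(* The carrier is identified with a subset of the reals through an order
   embedding phi. *)
Definition real_chain (R : realType) d (L : porderType d) : Prop :=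
  exists (phi : L -> R) (a b : R),
    [/\ {mono phi : x y / x <= y}, a < b &
        range phi = `[a, b]%classic \/
        [/\ finite_set (range phi), (range phi `<=` `[a, b])%classic,
            range phi a & range phi b]].

Definition no_zero_divisors d (L : linResLatticeType d) : Prop :=
  forall x y : L, tens x y = \bot -> x = \bot \/ y = \bot.

Variant dragonfly (L : Type) := Known of L | Unknown.
Arguments Unknown {L}.

Section DragonflyOrder.
Context {d : Order.disp_t}.

Definition dragonfly_option (L : Type) (x : dragonfly L) : option L :=
  if x is Known a then Some a else None.

Definition option_dragonfly (L : Type) (x : option L) : dragonfly L :=
  if x is Some a then Known a else Unknown.

Lemma dragonfly_optionK L : cancel (@dragonfly_option L) (@option_dragonfly L).
Proof. by case. Qed.

HB.instance Definition _ (L : choiceType) :=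
  Choice.copy (dragonfly L) (can_type (@dragonfly_optionK L)).

Variable L : tbOrderType d.
Implicit Types x y z : dragonfly L.

Definition dle x y : bool :=
  match x, y with
  | Known a, Known b => a <= b
  | Known a, Unknown => a == \bot
  | Unknown, Known b => b != \bot
  | Unknown, Unknown => true
  end.

Lemma dle_refl : reflexive dle.
Proof. by case=> [a|] /=. Qed.

Lemma dle_anti : antisymmetric dle.
Proof.
case=> [a|] [b|] //=; first by move=> /le_anti ->.
  by case: (a == \bot).
by case: (b == \bot).
Qed.

Lemma dle_trans : transitive dle.
Proof.
case=> [b|] [a|] [c|] //=.
- exact: le_trans.
- by move=> ab /eqP b0; rewrite -lex0 -b0.
- by rewrite -!lt0x; apply: lt_le_trans.
- by move=> /eqP -> _; apply: le0x.
Qed.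

Lemma dle_total : total dle.
Proof.
case=> [a|] [b|] //=; first exact: le_total.
  by case: (a == \bot).
by case: (b == \bot).
Qed.

HB.instance Definition _ :=
  Order.Le_isPOrder.Build d (dragonfly L) dle_refl dle_anti dle_trans.
HB.instance Definition _ :=
  Order.POrder_isTotal.Build d (dragonfly L) dle_total.

Lemma dle0x x : Known (\bot : L) <= x.
Proof. by case: x => [a|]; rewrite /Order.le /= ?le0x ?eqxx. Qed.

End DragonflyOrder.

Section Dragonfly.
Context {d : Order.disp_t} (L : linResLatticeType d).

Lemma dlex1 (x : dragonfly L) : x <= Known \top.
Proof.
by case: x => [a|]; rewrite /Order.le /= ?lex1 // eq_sym bot_neq_top.
Qed.

HB.instance Definition _ :=
  Order.hasBottom.Build d (dragonfly L) (@dle0x d L).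
HB.instance Definition _ :=
  Order.hasTop.Build d (dragonfly L) dlex1.

Definition dtens (x y : dragonfly L) : dragonfly L :=
  match x, y with
  | Known a, Known b => Known (tens a b)
  | Known a, Unknown | Unknown, Known a =>
      if a == \bot then Known \bot else Unknown
  | Unknown, Unknown => Unknown
  end.

Record capacity (n : nat) (mu : {set 'I_n} -> dragonfly L) : Prop := {
  capacity_set0 : mu finset.set0 = Known \bot;
  capacity_setT : mu [set: 'I_n] = Known \top;
  capacity_mono : forall A B : {set 'I_n}, A \subset B -> mu A <= mu B
}.

(* The joins and meets are those of the linear order on [dragonfly L], so the
   empty meet is [Known \top]. *)
Definition dpr_integral (n : nat) (mu : {set 'I_n} -> dragonfly L)
    (f : 'I_n -> dragonfly L) : dragonfly L :=
  \join_(A : {set 'I_n}) dtens (mu A) (\meet_(i in A) f i).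

End Dragonfly.

(* Main.v *)
Require Import Defs.
From mathcomp Require Import all_boot all_order all_algebra.
From mathcomp Require Import reals.

(** The integral is a finite join of terms [dtens (mu A) (\meet_(i in A) f i)].
    Finite joins and meets are monotone in their arguments, so everything rests
    on the monotonicity of the dragonfly multiplication in its second argument
    ([dtens_le2l]).  On known values this is residuation.  The delicate
    comparison is between the unknown value and a known nonzero [c]: for nonzero
    [a] it requires [Unknown <= Known (tens a c)], that is [tens a c != \bot],
    and this is exactly the absence of zero divisors. *)

Import Order.TTheory.
Local Open Scope order_scope.

Section Monotonicity.
Context {d : Order.disp_t} {L : linResLatticeType d}.

Lemma tens_le2l (a b c : L) : b <= c -> tens a b <= tens a c.
Proof.
rewrite ![tens a _]tensC tens_imp => /le_trans; apply.
by rewrite -tens_imp.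
Qed.

Lemma tensx0 (a : L) : tens a \bot = \bot.
Proof. by apply/eqP; rewrite -lex0 tensC tens_imp le0x. Qed.

Lemma tens_neq0 (a b : L) : no_zero_divisors L ->
  a != \bot -> b != \bot -> tens a b != \bot.
Proof.
by move=> nzd a0 b0; apply/eqP => /nzd[] /eqP; apply/negP.
Qed.

(** Without the hypothesis on zero divisors this fails: if [tens a c = \bot]
    with [a] and [c] nonzero, then [Unknown < Known c], whereas [Known a] times
    [Unknown] is [Unknown] and [Known a] times [Known c] is the bottom. *)
Lemma dtens_le2l (x y z : dragonfly L) : no_zero_divisors L ->
  y <= z -> dtens x y <= dtens x z.
Proof.
move=> nzd; case: x y z => [a|] [b|] [c|] //=.
- exact: tens_le2l.
- by move=> /eqP ->; rewrite tensx0 dle0x.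
- move=> c0; case: eqVneq => [_|a0]; first exact: dle0x.
  exact: tens_neq0.
- case: (eqVneq b) => [_ _|b0 le_bc]; first exact: dle0x.
  have bc : b <= c := le_bc.
  suff /negPf -> : c != \bot by [].
  by rewrite -lt0x (lt_le_trans _ bc) ?lt0x.
- by move=> /eqP ->; rewrite eqxx dle0x.
- by move=> /negPf ->.
Qed.

End Monotonicity.

Theorem theorem1 (R : realType) (d : Order.disp_t) (L : linResLatticeType d)
    (L_real : real_chain R L) (L_nzd : no_zero_divisors L)
    (n : nat) (n_gt0 : (0 < n)%N)
    (mu : {set 'I_n} -> dragonfly L) (mu_cap : capacity mu)
    (f g : 'I_n -> dragonfly L) (le_fg : forall i : 'I_n, f i <= g i) :
  dpr_integral mu f <= dpr_integral mu g.
Proof.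
apply/joinsP => A _; apply: (joins_min (j := A)) => //.
apply: dtens_le2l => //.
by apply/meetsP => i Ai; apply: (meets_max (j := i)) => //; apply: le_fg.
Qed.
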